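(* Let $G$ be a finite simple connected graph with $\omega(G)\ge 2$ that contains no induced subgraph isomorphic to $P_5$ or to $K_1+2K_2$. Then $\chi(G)\le \frac{3}{2}\left(\omega^2(G)-\omega(G)\right)$.
   Context: $P_5$ is the path on 5 vertices, $K_t$ the complete graph on $t$ vertices. For disjoint graphs $F_1,F_2$, $F_1\cup F_2$ is their disjoint union, $kF$ is the disjoint union of $k$ copies of $F$, and $F_1+F_2$ is the join (disjoint union plus all edges between $V(F_1)$ and $V(F_2)$). Thus $K_1+2K_2$ is a vertex adjacent to all four vertices of two disjoint edges. $\chi$ is the chromatic number and $\omega$ the clique number. *)

(* Defs.v *)
From HB Require Import structures.
From mathcomp Require Import all_boot all_order all_algebra.

Set Implicit Arguments.
Unset Strict Implicit.
Unset Printing Implicit Defensive.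

Record sgraph := SGraph {
  vertex :> finType;
  adj : rel vertex;
  adj_sym : symmetric adj;
  adj_irr : irreflexive adj
}.
Arguments adj {s} : rename.

Section Path.
Variable n : nat.
Definition path_adj : rel 'I_n :=
  fun i j => (i.+1 == j :> nat) || (j.+1 == i :> nat).
Fact path_adj_sym : symmetric path_adj.
Proof. by move=> i j; rewrite /path_adj orbC. Qed.
Fact path_adj_irr : irreflexive path_adj.
Proof. by move=> i; rewrite /path_adj orbb; apply/eqP/nesym/n_Sn. Qed.
(* The path on n vertices (not n edges). *)
Definition path_graph : sgraph := SGraph path_adj_sym path_adj_irr.
End Path.

Section Complete.
Variable n : nat.
Definition complete_adj : rel 'I_n := fun i j => i != j.
Fact complete_adj_sym : symmetric complete_adj.
Proof. by move=> i j; rewrite /complete_adj eq_sym. Qed.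
Fact complete_adj_irr : irreflexive complete_adj.
Proof. by move=> i; rewrite /complete_adj eqxx. Qed.
Definition complete_graph : sgraph := SGraph complete_adj_sym complete_adj_irr.
End Complete.

Section Join.
Variables F1 F2 : sgraph.
Definition join_adj : rel (F1 + F2)%type := fun u v =>
  match u, v with
  | inl x, inl y => adj x y
  | inr x, inr y => adj x y
  | _, _ => true
  end.
Fact join_adj_sym : symmetric join_adj.
Proof. by move=> [x|x] [y|y] //=; rewrite adj_sym. Qed.
Fact join_adj_irr : irreflexive join_adj.
Proof. by move=> [x|x] /=; rewrite adj_irr. Qed.
Definition join_graph : sgraph := SGraph join_adj_sym join_adj_irr.
End Join.

Section Copies.
Variables (k : nat) (F : sgraph).
Definition copies_adj : rel ('I_k * F)%type :=
  fun u v => (u.1 == v.1) && adj u.2 v.2.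
Fact copies_adj_sym : symmetric copies_adj.
Proof. by move=> u v; rewrite /copies_adj eq_sym adj_sym. Qed.
Fact copies_adj_irr : irreflexive copies_adj.
Proof. by move=> u; rewrite /copies_adj adj_irr andbF. Qed.
(* The disjoint union kF; the first component names the copy. *)
Definition copies_graph : sgraph := SGraph copies_adj_sym copies_adj_irr.
End Copies.

Section Induced.
Variables (G : sgraph) (A : {set G}).
Definition induced_adj : rel {x : G | x \in A} := fun u v => adj (val u) (val v).
Fact induced_adj_sym : symmetric induced_adj.
Proof. by move=> u v; apply: adj_sym. Qed.
Fact induced_adj_irr : irreflexive induced_adj.
Proof. by move=> u; apply: adj_irr. Qed.
Definition induced : sgraph := SGraph induced_adj_sym induced_adj_irr.
End Induced.

Definition isomorphic (G H : sgraph) : Prop :=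
  exists2 f : G -> H, bijective f & {mono f : x y / adj x y}.

Definition induced_free (G H : sgraph) : Prop :=
  ~ exists A : {set G}, isomorphic (induced A) H.

Definition connected (G : sgraph) : Prop := forall x y : G, connect adj x y.

Definition clique (G : sgraph) (A : {set G}) : bool :=
  [forall x in A, forall y in A, (x != y) ==> adj x y].

Definition clique_number (G : sgraph) : nat := \max_(A : {set G} | clique A) #|A|.

Definition colorable (G : sgraph) (k : nat) : bool :=
  [exists c : {ffun G -> 'I_k}, forall x, forall y, adj x y ==> (c x != c y)].

Fact colorable_exists (G : sgraph) : exists k, colorable G k.
Proof.
exists #|G|; apply/existsP; exists [ffun x => enum_rank x].
apply/forallP=> x; apply/forallP=> y; apply/implyP=> xy; rewrite !ffunE.
by apply: contraTneq xy => /enum_rank_inj ->; rewrite adj_irr.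
Qed.

Definition chromatic_number (G : sgraph) : nat := ex_minn (colorable_exists G).

(* Main.v *)
(** A connected [P_5]-free graph has a dominating clique or a dominating path on
    three vertices (Bacsó-Tuza).  Since [G] has no [K_1 + 2K_2], every
    neighbourhood is [2K_2]-free with clique number less than [omega], hence
    ['C(omega, 2)]-colourable (Wagon).  Three neighbourhoods cover [G] if there
    is a dominating path.  If there is a dominating clique, two neighbourhoods
    of its vertices cover everything but at most [omega - 2] stable sets.  In
    both cases [3 * 'C(omega, 2)] colours suffice. *)

Require Import Defs.
From mathcomp Require Import all_boot all_order all_algebra.
From mathcomp Require Import zify lra.

Set Implicit Arguments.
Unset Strict Implicit.
Unset Printing Implicit Defensive.

(** * Forbidden induced subgraphs as forbidden vertex configurations *)

Lemma induced_free_mono (G H : sgraph) (g : H -> G) :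
  induced_free G H -> injective g -> {mono g : x y / adj x y} -> False.
Proof.
move=> free g_inj g_mono; apply: free; exists (g @: [set: H]).
have gP (x : H) : g x \in g @: [set: H] by apply: imset_f.
pose h (x : H) : induced (g @: [set: H]) := exist _ (g x) (gP x).
have h_inj : injective h by move=> x y /(congr1 val) /g_inj.
have [k hk kh] : bijective h.
  apply: inj_card_bij => //=.
  by rewrite card_sig card_imset // cardsT.
exists k; first by exists h.
by move=> x y; rewrite -{2}[x]kh -{2}[y]kh /= /induced_adj /= g_mono.
Qed.

(** Vertices with the same image have the same neighbours. In both forbidden graphs distinct
    vertices have distinct neighbourhoods, so injectivity is automatic. *)
Lemma mono_adj_inj (G H : sgraph) (g : H -> G) :
  (forall x y : H, (forall z, adj x z = adj y z) -> x = y) ->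
  {mono g : x y / adj x y} -> injective g.
Proof.
by move=> twins g_mono x y gxy; apply: twins => z; rewrite -!g_mono gxy.
Qed.

Section ForbiddenConfigurations.
Variable G : sgraph.
Implicit Types a b c d e v : G.

Lemma P5_free_path a b c d e : induced_free G (path_graph 5) ->
  adj a b -> adj b c -> adj c d -> adj d e ->
  adj a c = false -> adj a d = false -> adj a e = false ->
  adj b d = false -> adj b e = false -> adj c e = false -> False.
Proof.
move=> free ab bc cd de ac ad ae bd be ce.
pose g (i : path_graph 5) := nth a [:: a; b; c; d; e] i.
have g_mono : {mono g : x y / adj x y}.
  move=> [[|[|[|[|[|//]]]]] ?] [[|[|[|[|[|//]]]]] ?];
  by rewrite /g /= /path_adj /= ?adj_irr // adj_sym.
apply: (induced_free_mono free _ g_mono); apply: mono_adj_inj g_mono.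
move=> x y; rewrite /= => xy.
have := (xy (inord 0), xy (inord 1), xy (inord 2), xy (inord 3), xy (inord 4)).
rewrite /path_adj !inordK //.
move: x y {xy} => [[|[|[|[|[|//]]]]] ?] [[|[|[|[|[|//]]]]] ?];
by [move=> ?; apply: val_inj | move=> /= [[[[]]]]].
Qed.

Lemma butterfly_free_nbhd v a b c d :
  induced_free G (join_graph (complete_graph 1)
                             (copies_graph 2 (complete_graph 2))) ->
  adj v a -> adj v b -> adj v c -> adj v d -> adj a b -> adj c d ->
  adj a c = false -> adj a d = false ->
  adj b c = false -> adj b d = false -> False.
Proof.
move=> free va vb vc vd ab cd ac ad bc bd.
pose H := join_graph (complete_graph 1) (copies_graph 2 (complete_graph 2)).
(* Vertex [j] of copy [i] goes to position [2 * i + j] of the list, so the two edges are [a b] and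
   [c d]. *)
pose g (i : H) :=
  match i with inl _ => v | inr u => nth v [:: a; b; c; d] (u.1.*2 + u.2) end.
have g_mono : {mono g : x y / adj x y}.
  move=> [[[|//] ?]|[[[|[|//]] ?] [[|[|//]] ?]]]
         [[[|//] ?]|[[[|[|//]] ?] [[|[|//]] ?]]];
  rewrite /g /= /complete_adj /copies_adj /= ?adj_irr // 1?adj_sym;
  by rewrite ?adj_irr // ?ab ?cd.
apply: (induced_free_mono free _ g_mono); apply: mono_adj_inj g_mono.
move=> x y xy.
have := (xy (inl ord0), xy (inr (ord0, ord0)), xy (inr (ord0, ord_max)),
         xy (inr (ord_max, ord0)), xy (inr (ord_max, ord_max))).
move: x y {xy} => [[[|//] ?]|[[[|[|//]] ?] [[|[|//]] ?]]]
                  [[[|//] ?]|[[[|[|//]] ?] [[|[|//]] ?]]];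
rewrite /= /complete_adj /copies_adj /=;
by [move=> ?; congr inl; apply: val_inj
   |move=> ?; congr (inr (_, _)); apply: val_inj | move=> [[[[]]]]].
Qed.

End ForbiddenConfigurations.

(** * Dominating cliques and three-vertex paths in P_5-free graphs *)

Section Domination.
Variable G : sgraph.
Hypothesis GP5 : induced_free G (path_graph 5).
Implicit Types (D K : {set G}) (p q r s u w z : G).

Definition closed_nbhd D : {set G} := [set x | [exists d in D, (x == d) || adj x d]].

Lemma closed_nbhdP D x :
  reflect (exists2 d, d \in D & (x == d) || adj x d) (x \in closed_nbhd D).
Proof. by rewrite inE; apply: (iffP exists_inP). Qed.

Lemma sub_closed_nbhd D : D \subset closed_nbhd D.
Proof. by apply/subsetP=> x xD; apply/closed_nbhdP; exists x; rewrite ?eqxx. Qed.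

Lemma adj_closed_nbhd D x d : d \in D -> adj x d -> x \in closed_nbhd D.
Proof. by move=> dD xd; apply/closed_nbhdP; exists d; rewrite ?xd ?orbT. Qed.

Lemma notin_closed_nbhd D x d : x \notin closed_nbhd D -> d \in D -> adj x d = false.
Proof. by move=> xD dD; apply: contraNF xD; apply: adj_closed_nbhd. Qed.

Lemma closed_nbhdS D D' : D \subset closed_nbhd D' ->
  (forall s d, s \notin closed_nbhd D' -> d \in D -> adj s d -> False) ->
  closed_nbhd D \subset closed_nbhd D'.
Proof.
move=> sub sub'; apply/subsetP=> s /closed_nbhdP[d dD /predU1P[->|sd]].
  exact: (subsetP sub).
by apply/negPn/negP=> sD'; apply: sub' sD' dD sd.
Qed.

Lemma closed_nbhd_adj D D' s : D \subset closed_nbhd D' ->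
  s \in closed_nbhd D -> s \notin closed_nbhd D' -> exists2 d, d \in D & adj s d.
Proof.
move=> sub /closed_nbhdP[d dD /predU1P[->|sd] sD']; last by exists d.
by rewrite (subsetP sub) in sD'.
Qed.

Lemma cliqueP K : reflect {in K &, forall x y, x != y -> adj x y} (clique K).
Proof.
apply: (iffP forall_inP) => [h x y xK yK | h x xK].
  by move: (h x xK) => /forall_inP/(_ y yK)/implyP.
by apply/forall_inP=> y yK; apply/implyP; apply: h.
Qed.

Lemma set3P p q r x : reflect [\/ x = p, x = q | x = r] (x \in [set p; q; r]).
Proof. by rewrite !inE -orbA; apply: (iffP or3P) => -[/eqP|/eqP|/eqP]; constructor. Qed.

Lemma set3_1 p q r : p \in [set p; q; r]. Proof. by rewrite !inE eqxx. Qed.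
Lemma set3_2 p q r : q \in [set p; q; r]. Proof. by rewrite !inE eqxx orbT. Qed.
Lemma set3_3 p q r : r \in [set p; q; r]. Proof. by rewrite !inE eqxx orbT. Qed.

Lemma set3C p q r : [set r; q; p] = [set p; q; r].
Proof. by apply/setP=> x; rewrite !inE orbC [(x == r) || _]orbC orbA. Qed.

Lemma notin_closed_nbhd3 p q r s : s \notin closed_nbhd [set p; q; r] ->
  [/\ adj s p = false, adj s q = false & adj s r = false].
Proof. by move=> sD; split; apply: notin_closed_nbhd sD _; rewrite !inE eqxx ?orbT. Qed.

(* The third vertex may or may not be adjacent to the first. *)
Definition path3 D :=
  exists p q r, [/\ D = [set p; q; r], adj p q & adj q r].

Definition clique_or_path3 D := (D != set0 /\ clique D) \/ path3 D.

(** Used when [w] has an undominated neighbour: [D'] contains [w], so it dominates that neighbour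
    too and domination strictly grows. *)
Definition improvable D w :=
  exists D', [/\ clique_or_path3 D', w \in D' & closed_nbhd D \subset closed_nbhd D'].

Lemma path3_good p q r : adj p q -> adj q r -> clique_or_path3 [set p; q; r].
Proof. by right; exists p, q, r. Qed.

Ltac adjs := first [ assumption | rewrite adj_sym; assumption ].
Ltac p5 a b c d e := exfalso; apply: (@P5_free_path G a b c d e GP5); adjs.

(** The first candidate is the clique of [w] and its neighbours in [K]. If it loses a vertex [u],
    the path [a0 w z] takes over, where [a0] in [K] is a neighbour of [w]. *)
Lemma clique_improvable K w z : clique K ->
  adj w z -> w \in closed_nbhd K -> z \notin closed_nbhd K -> improvable K w.
Proof.
move=> /cliqueP Kcl wz wK zK.
have zKF d : d \in K -> adj z d = false by apply: notin_closed_nbhd zK.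
pose A := [set a in K | adj w a].
have [a0] : exists a, a \in A.
  case/closed_nbhdP: wK => d dK /predU1P[wd|wd].
    by move: (zKF d dK); rewrite -wd adj_sym wz.
  by exists d; rewrite inE dK.
rewrite inE => /andP[a0K wa0]; have za0 := zKF _ a0K.
have Kcov D' : a0 \in D' -> K \subset closed_nbhd D'.
  move=> a0D'; apply/subsetP=> k kK; have [->|ka0] := eqVneq k a0.
    exact: (subsetP (sub_closed_nbhd _)).
  by apply: (adj_closed_nbhd a0D'); apply: Kcl.
have a0A : a0 \in w |: A by rewrite !inE a0K wa0 orbT.
(* A vertex lost by the clique candidate sees [z]; otherwise [u b a0 w z] is an induced P_5. *)
have und u : u \in closed_nbhd K -> u \notin closed_nbhd (w |: A) -> adj u z.
  move=> uK uA; have [b bK ub] := closed_nbhd_adj (Kcov _ a0A) uK uA.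
  have uw : adj u w = false by apply: notin_closed_nbhd uA _; rewrite !inE eqxx.
  have ua0 : adj u a0 = false by apply: notin_closed_nbhd uA _.
  have wb : adj w b = false.
    apply/negbTE/negP=> wb.
    by rewrite (notin_closed_nbhd uA) ?inE ?bK ?wb ?orbT in ub.
  have zb := zKF _ bK.
  have ba0 : adj b a0 by apply: Kcl => //; apply: contraTneq ub => ->; rewrite ua0.
  by apply: contraT => /negbTE uz; p5 u b a0 w z.
have [sub|/subsetPn[u uK uA]] :=
  boolP (closed_nbhd K \subset closed_nbhd (w |: A)).
  exists (w |: A); split=> //; last by rewrite !inE eqxx.
  left; split; first by apply/set0Pn; exists w; rewrite !inE eqxx.
  apply/cliqueP=> x y; rewrite !inE => /predU1P[->|/andP[xK wx]] /predU1P[->|/andP[yK wy]].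
  - by rewrite eqxx.
  - by [].
  - by rewrite adj_sym.
  - exact: Kcl.
have uz := und u uK uA.
have uw : adj u w = false by apply: notin_closed_nbhd uA _; rewrite !inE eqxx.
have ua0 : adj u a0 = false by apply: notin_closed_nbhd uA _.
exists [set a0; w; z]; split; [by apply: path3_good; adjs | exact: set3_2 |].
apply/subsetP=> s sK; apply: contraT => sD.
have [sa0 sw sz] := notin_closed_nbhd3 sD.
(* As [s] does not see [z], the first candidate does not lose it, so it sees some [d] in [A]. An
   induced P_5 through [u], [z], [w] then arises whether or not [s] sees [u]. *)
have /closed_nbhdP[d] : s \in closed_nbhd (w |: A).
  by apply: contraT => sA; rewrite und in sz.
rewrite !inE => /predU1P[->|/andP[dK wd]] /predU1P[sd|sd].
- by move: sz; rewrite sd wz.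
- by rewrite sw in sd.
- by move: sw; rewrite sd adj_sym wd.
have zd := zKF _ dK.
have ud : adj u d = false by apply: notin_closed_nbhd uA _; rewrite !inE dK wd orbT.
case su: (adj s u); last by p5 s d w z u.
by p5 s u z w a0.
Qed.

(** * Exchanging an induced three-vertex path *)

Section InducedPath3.
Variables p q r w z : G.
Hypotheses (pq : adj p q) (qr : adj q r) (pr : adj p r = false).
Hypotheses (wz : adj w z).
Hypotheses (zp : adj z p = false) (zq : adj z q = false) (zr : adj z r = false).

Let D := [set p; q; r].

Lemma path3_cover D' :
  [|| p \in D', adj p w && (w \in D') | adj p q && (q \in D')] ->
  [|| q \in D', adj q w && (w \in D') | adj q p && (p \in D')] ->
  [|| r \in D', adj r w && (w \in D') | adj r q && (q \in D')] ->
  D \subset closed_nbhd D'.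
Proof.
have cov x y y' : [|| x \in D', adj x y && (y \in D') | adj x y' && (y' \in D')] ->
    x \in closed_nbhd D'.
  case/or3P=> [xD|/andP[xy yD]|/andP[xy yD]].
  - exact: (subsetP (sub_closed_nbhd _)).
  - exact: adj_closed_nbhd xy.
  - exact: adj_closed_nbhd xy.
by move=> /cov ? /cov ? /cov ?; apply/subsetP=> x /set3P[]->.
Qed.

(** Here and in the cases below, a candidate without [z] is tried first, unless [w] sees only [q]. A
    vertex it loses has exactly one neighbour in [D] and is shown to see [z]; this rules out any
    loss for a path ending in [w z]. *)
Lemma improvable_nonadj_mid : adj w p -> adj w r -> adj w q = false -> improvable D w.
Proof.
move=> wp wr wq.
have cov : D \subset closed_nbhd [set p; w; r].
  by apply: path3_cover; rewrite ?set3_1 ?set3_3 ?(adj_sym q p) ?pq ?orbT.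
have [sub|/subsetPn[t tD tD']] :=
  boolP (closed_nbhd D \subset closed_nbhd [set p; w; r]).
  by exists [set p; w; r]; split; [apply: path3_good; adjs | exact: set3_2 |].
have [tp tw tr] := notin_closed_nbhd3 tD'.
have tq : adj t q.
  by have [d /set3P[]->] := closed_nbhd_adj cov tD tD'; rewrite ?tp ?tr.
have tz : adj t z by apply: contraT => /negbTE tz; p5 t q p w z.
exists [set p; w; z]; split; [by apply: path3_good; adjs | exact: set3_2 |].
apply: closed_nbhdS => [|s d /notin_closed_nbhd3[sp sw sz] dD sd].
  by apply: path3_cover; rewrite ?set3_1 ?set3_2 ?(adj_sym r w) ?wr ?(adj_sym q p) ?pq ?orbT.
case sr: (adj s r).
  case st: (adj s t); last by p5 s r w z t.
  by p5 s t z w p.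
have sq : adj s q by case/set3P: dD sd => ->; rewrite ?sp ?sr.
by p5 s q p w z.
Qed.

(** A vertex lost by [q w z] sees [p] or [r] and extends [p q w z] or [r q w z] to an induced
    P_5. *)
Lemma improvable_adj_mid : adj w p = false -> adj w q -> adj w r = false -> improvable D w.
Proof.
move=> wp wq wr.
exists [set q; w; z]; split; [by apply: path3_good; adjs | exact: set3_2 |].
apply: closed_nbhdS => [|s d /notin_closed_nbhd3[sq sw sz] dD sd].
  by apply: path3_cover; rewrite ?set3_1 ?(adj_sym r q) ?pq ?qr ?orbT.
by case/set3P: dD sd => -> sd; [p5 s p q w z | rewrite sq in sd | p5 s r q w z].
Qed.

Lemma improvable_adj_left : adj w p -> adj w q -> adj w r = false -> improvable D w.
Proof.
move=> wp wq wr.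
have cov : D \subset closed_nbhd [set p; q; w].
  by apply: path3_cover; rewrite ?set3_1 ?set3_2 ?(adj_sym r q) ?qr ?orbT.
have [sub|/subsetPn[u uD uD']] :=
  boolP (closed_nbhd D \subset closed_nbhd [set p; q; w]).
  by exists [set p; q; w]; split; [apply: path3_good; adjs | exact: set3_3 |].
have [up uq uw] := notin_closed_nbhd3 uD'.
have ur : adj u r.
  by have [d /set3P[]->] := closed_nbhd_adj cov uD uD'; rewrite ?up ?uq.
have uz : adj u z by apply: contraT => /negbTE uz; p5 u r q w z.
exists [set q; w; z]; split; [by apply: path3_good; adjs | exact: set3_2 |].
apply: closed_nbhdS => [|s d /notin_closed_nbhd3[sq sw sz] dD sd].
  by apply: path3_cover; rewrite ?set3_1 ?(adj_sym r q) ?pq ?qr ?orbT.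
case/set3P: dD sd => -> sd; [| by rewrite sq in sd | by p5 s r q w z].
case su: (adj s u); last by p5 s p w z u.
by p5 s u z w q.
Qed.

(** Candidate [q w p] can only lose a vertex [u] attached to [r], and [q w r] only a vertex [t]
    attached to [p]. Both are needed: a vertex lost by [q w z] is refuted with [u] if it sees [p],
    with [t] if it sees [r]. *)
Lemma improvable_adj_all : adj w p -> adj w q -> adj w r -> improvable D w.
Proof.
move=> wp wq wr.
have covp : D \subset closed_nbhd [set q; w; p].
  by apply: path3_cover; rewrite ?set3_1 ?set3_3 ?(adj_sym r q) ?qr ?orbT.
have covr : D \subset closed_nbhd [set q; w; r].
  by apply: path3_cover; rewrite ?set3_1 ?set3_3 ?pq ?orbT.
have [sub|/subsetPn[u uD uD']] :=
  boolP (closed_nbhd D \subset closed_nbhd [set q; w; p]).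
  by exists [set q; w; p]; split; [apply: path3_good; adjs | exact: set3_2 |].
have [uq uw up] := notin_closed_nbhd3 uD'.
have ur : adj u r.
  by have [d /set3P[]->] := closed_nbhd_adj covp uD uD'; rewrite ?up ?uq.
have [sub|/subsetPn[t tD tD']] :=
  boolP (closed_nbhd D \subset closed_nbhd [set q; w; r]).
  by exists [set q; w; r]; split; [apply: path3_good; adjs | exact: set3_2 |].
have [tq tw tr] := notin_closed_nbhd3 tD'.
have tp : adj t p.
  by have [d /set3P[]->] := closed_nbhd_adj covr tD tD'; rewrite ?tr ?tq.
have ut : adj u t by apply: contraT => /negbTE ut; p5 u r q p t.
have [uz tz] : adj u z /\ adj t z.
  case uz: (adj u z); case tz: (adj t z) => //.
  - by p5 t u z w q.
  - by p5 u t z w q.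
  - by p5 u t p w z.
exists [set q; w; z]; split; [by apply: path3_good; adjs | exact: set3_2 |].
apply: closed_nbhdS => [|s d /notin_closed_nbhd3[sq sw sz] dD sd].
  by apply: path3_cover; rewrite ?set3_1 ?(adj_sym r q) ?pq ?qr ?orbT.
case/set3P: dD sd => -> sd; [| by rewrite sq in sd |].
  case su: (adj s u); last by p5 s p w z u.
  by p5 s u z w q.
case st: (adj s t); last by p5 s r w z t.
by p5 s t z w q.
Qed.

End InducedPath3.

(** A triangle is a clique; otherwise [p q r] is induced and the neighbours of [w] on it decide. If
    [w] sees only an end, [w z] prolongs the path to an induced P_5; seeing [q] and [r] mirrors
    seeing [p] and [q]. *)
Lemma path3_improvable D w z : path3 D ->
  adj w z -> w \in closed_nbhd D -> z \notin closed_nbhd D -> improvable D w.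
Proof.
move=> [p [q [r [-> pq qr]]]] wz wD zD.
case pr: (adj p r).
  apply: clique_improvable wz wD zD.
  by apply/cliqueP=> x y /set3P[]-> /set3P[]-> xy //; try adjs; rewrite eqxx in xy.
have [zp zq zr] := notin_closed_nbhd3 zD.
have rq : adj r q by adjs. have qp : adj q p by adjs.
have rp : adj r p = false by adjs.
have : [|| adj w p, adj w q | adj w r].
  case/closed_nbhdP: wD => d dD /predU1P[wd|wd].
    by rewrite wd adj_sym (notin_closed_nbhd zD dD) in wz.
  by case/set3P: dD wd => -> ->; rewrite ?orbT.
case wp: (adj w p); case wq: (adj w q); case wr: (adj w r) => // _.
- exact: (@improvable_adj_all p q r w z).
- exact: (@improvable_adj_left p q r w z).
- exact: (@improvable_nonadj_mid p q r w z).
- by p5 r q p w z.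
- by rewrite -set3C; apply: (@improvable_adj_left r q p w z).
- exact: (@improvable_adj_mid p q r w z).
- by p5 p q r w z.
Qed.

(* Bacsó and Tuza's theorem.  As long as some vertex [z] is undominated, there
   is one with a dominated neighbour [w], and [D] can be exchanged for a set
   that contains [w] and dominates strictly more. *)
Theorem P5_free_dominating : connected G -> G ->
  exists2 D, clique_or_path3 D & closed_nbhd D = setT.
Proof.
move=> Gconn x0.
have step n D : clique_or_path3 D -> #|~: closed_nbhd D| < n ->
    exists2 D, clique_or_path3 D & closed_nbhd D = setT.
  elim: n D => // n IHn D Dgood Dn.
  have [DT|/eqP DT] := eqVneq (closed_nbhd D) setT; first by exists D.
  have [z zD] : exists z, z \notin closed_nbhd D.
    apply/existsP; apply: contra_notT DT => /existsPn h.
    by apply/setP=> z; rewrite (negPn (h z)) inE.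
  have [d dD] : exists d, d \in D.
    by case: Dgood => [[/set0Pn//]|[p [q [r [-> _ _]]]]]; exists p; apply: set3_1.
  have {dD} dD := subsetP (sub_closed_nbhd D) _ dD.
  (* A path from a dominated to an undominated vertex leaves the dominated set along some edge. *)
  have [w [z' [wz wD z'D]]] :
      exists w z', [/\ adj w z', w \in closed_nbhd D & z' \notin closed_nbhd D].
    have /connectP[s dz zs] := Gconn d z.
    elim: s d dD dz zs => [|y s IHs] d dD /=; first by move=> _ zd; rewrite zd dD in zD.
    case/andP=> dy ys zs; have [yD|yD] := boolP (y \in closed_nbhd D).
      exact: IHs yD ys zs.
    by exists d, y.
  have [D' [D'good wD' sub]] : improvable D w.
    case: (Dgood) => [[_ Dcl]|Dp]; first exact: clique_improvable wz _ _.
    exact: path3_improvable wz _ _.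
  apply: (IHn D') => //; rewrite ltnS in Dn; apply: leq_trans Dn; apply: proper_card.
  rewrite properE !setCS sub.
  by apply/subsetPn; exists z' => //; apply: (adj_closed_nbhd wD'); rewrite adj_sym.
apply: (step #|~: closed_nbhd [set x0]|.+1 [set x0]) => //; left; split.
  by apply/set0Pn; exists x0; apply: set11.
by apply/cliqueP=> x y /set1P-> /set1P->; rewrite eqxx.
Qed.

End Domination.

(** * Colouring vertex subsets; Wagon's bound for 2K_2-free sets *)

Section Coloring.
Variable G : sgraph.
Implicit Types (S T K : {set G}) (v x y : G).

(** [f] is total but constrained on [S] only, so colourings of overlapping sets combine without
    subtypes. *)
Definition set_colorable S k := exists f : G -> nat,
  {in S, forall x, f x < k} /\ {in S &, forall x y, adj x y -> f x != f y}.

(** Allows vertices or sets of vertices as colours; their positions in [enum B] serve as numbers. *)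
Lemma set_colorable_fin (C : finType) (B : {set C}) (f : G -> C) S k :
  {in S, forall x, f x \in B} -> {in S &, forall x y, adj x y -> f x != f y} ->
  #|B| <= k -> set_colorable S k.
Proof.
move=> fB f_col Bk; exists (fun x => index (f x) (enum B)); split=> [x xS|x y xS yS xy].
  by apply: leq_trans Bk; rewrite cardE index_mem mem_enum fB.
apply: contraNneq (f_col x y xS yS xy) => /(congr1 (nth (f x) (enum B))).
by rewrite !nth_index ?mem_enum ?fB // => ->.
Qed.

Lemma set_colorableU S T k l :
  set_colorable S k -> set_colorable T l -> set_colorable (S :|: T) (k + l).
Proof.
move=> [f [fk f_col]] [g [gl g_col]].
exists (fun x => if x \in S then f x else k + g x); split=> [x|x y].
  by rewrite inE; case: ifP => [/fk ? _|_ /= /gl ?]; [apply: ltn_addr | rewrite ltn_add2l].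
rewrite !inE; case: ifP => xS; case: ifP => yS /= xT yT xy.
- exact: f_col.
- by have := fk x xS; lia.
- by have := fk y yS; lia.
- by rewrite eqn_add2l g_col.
Qed.

Lemma set_colorableS S T k l :
  S \subset T -> k <= l -> set_colorable T k -> set_colorable S l.
Proof.
move=> /subsetP ST kl [f [fk f_col]]; exists f; split=> [x xS|x y xS yS].
  by apply: leq_trans kl; apply: fk; apply: ST.
by apply: f_col; apply: ST.
Qed.

Lemma set_colorable1 v : set_colorable [set v] 1.
Proof. by exists (fun=> 0); split=> // x y /set1P-> /set1P->; rewrite adj_irr. Qed.

Lemma chromatic_number_le k : set_colorable setT k -> chromatic_number G <= k.
Proof.
move=> [f [fk f_col]]; rewrite /chromatic_number; case: ex_minnP => m _; apply.
apply/existsP; exists [ffun x => Ordinal (fk x (in_setT x))].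
apply/forallP=> x; apply/forallP=> y; apply/implyP=> xy.
by rewrite !ffunE -val_eqE f_col ?inE.
Qed.

Lemma clique_card K : clique K -> #|K| <= clique_number G.
Proof. exact: leq_bigmax_cond. Qed.

(* Wagon's argument.  Fix a maximum clique [K] of [S] and colour [x] with one
   or two of its non-neighbours in [K], two whenever possible.  Vertices with
   the same two non-neighbours are nonadjacent as there is no [2K_2]; vertices
   with the same single non-neighbour are nonadjacent by maximality of [K]. *)
Lemma twoK2_free_set_colorable S m :
  (forall a b c d, a \in S -> b \in S -> c \in S -> d \in S ->
     adj a b -> adj c d -> adj a c = false -> adj a d = false ->
     adj b c = false -> adj b d = false -> False) ->
  (forall K, clique K -> K \subset S -> #|K| <= m) ->
  set_colorable S 'C(m.+1, 2).
Proof.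
move=> free Sm.
have P0 : clique (set0 : {set G}) && ((set0 : {set G}) \subset S).
  by rewrite sub0set andbT; apply/cliqueP=> x y; rewrite inE.
case: (@arg_maxnP _ set0 (fun K => clique K && (K \subset S)) (fun K => #|K|) P0).
move=> K /andP[Kcl KS] Kmax0.
have Kmax A : clique A && (A \subset S) -> #|A| <= #|K| by apply: Kmax0.
pose M x := [set v in K | ~~ adj x v].
(* A subset of this size always exists, so the default [set0] never stands in for a failed
   choice. *)
pose f x := odflt set0 [pick B : {set G} | (B \subset M x) && (#|B| == minn 2 #|M x|)].
have fP x : (f x \subset M x) /\ #|f x| = minn 2 #|M x|.
  rewrite /f; case: pickP => [B /andP[? /eqP]//|none] /=.
  have : 0 < 'C(#|M x|, minn 2 #|M x|) by rewrite bin_gt0 geq_minr.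
  rewrite -cards_draws card_gt0 => /set0Pn[B].
  by rewrite inE none.
(* If [x] saw all of [K], adding it would give a larger clique in [S]. *)
have M0 x : x \in S -> 0 < #|M x|.
  move=> xS; rewrite lt0n cards_eq0; apply/negP=> /eqP Mx.
  have xK v : v \in K -> adj x v.
    by move=> vK; apply: contraT => xv; rewrite -(in_set0 v) -Mx inE vK.
  have xnK : x \notin K by apply/negP=> /xK; rewrite adj_irr.
  suff /Kmax : clique (x |: K) && (x |: K \subset S).
    by rewrite cardsU1 xnK add1n ltnn.
  rewrite subUset sub1set xS KS !andbT; apply/cliqueP=> y z.
  rewrite !inE => /predU1P[->|yK] /predU1P[->|zK]; rewrite ?eqxx //.
  - by move=> _; apply: xK.
  - by move=> _; rewrite adj_sym; apply: xK.
  - exact: (cliqueP _ Kcl).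
have MK x : M x \subset K by apply/subsetP=> v; rewrite inE => /andP[].
pose C k := [set B : {set G} | B \subset K & #|B| == k].
apply: (@set_colorable_fin _ (C 1 :|: C 2) f) => [x xS|x y xS yS xy|].
- have [fM fc] := fP x; have := M0 x xS; rewrite !inE (subset_trans fM (MK x)) fc.
  by case: (ltnP 1 #|M x|) => M1 M0x; rewrite ?(minn_idPl M1) ?(minn_idPr M1) //=; lia.
- apply/eqP=> fxy; have [fMx fcx] := fP x; have [fMy fcy] := fP y.
  (* Two common non-neighbours [a], [b] in [K] would form an induced 2K_2 with the edge [x y]. *)
  have [M1|M1] := ltnP 1 #|f x|.
    have /card_gt1P[a [b [aB bB ab]]] := M1.
    have := subsetP fMx a aB; have := subsetP fMx b bB.
    rewrite fxy in aB bB; have := subsetP fMy a aB; have := subsetP fMy b bB.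
    rewrite !inE => /andP[bK /negbTE yb] /andP[aK /negbTE ya].
    move=> /andP[_ /negbTE xb] /andP[_ /negbTE xa].
    apply: (free x y a b) => //; rewrite ?(subsetP KS) //.
    exact: (cliqueP _ Kcl).
  have Mf z : z \in S -> #|f z| <= 1 -> M z = f z /\ #|M z| = 1.
    move=> zS fz1; have [fMz fcz] := fP z; have := M0 z zS => Mz0.
    have Mz1 : #|M z| = 1 by move: fz1 Mz0; rewrite fcz; case: #|M z| => [|[|[|n]]].
    by split=> //; apply/esym/eqP; rewrite eqEcard fMz fcz Mz1.
  have [Mx Mx1] := Mf x xS M1; rewrite fxy in M1; have [My _] := Mf y yS M1.
  have /cards1P[a Mxa] : #|M x| == 1 by rewrite Mx1.
  have Mya : M y = [set a] by rewrite My -fxy -Mx.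
  have aK : a \in K by apply: (subsetP (MK x)); rewrite Mxa set11.
  have adjK z : M z = [set a] -> forall v, v \in K -> v != a -> adj z v.
    move=> Mz v vK; apply: contraNT => zv; rewrite -in_set1 -Mz inE vK.
    exact: zv.
  have notK z : M z = [set a] -> z \notin K :\ a.
    move=> Mz; apply/negP; rewrite !inE => /andP[za zK].
    by have := adjK z Mz z zK za; rewrite adj_irr.
  have xyK : x \notin y |: K :\ a.
    rewrite in_setU1 negb_or notK // andbT.
    by apply: contraTneq xy => ->; rewrite adj_irr.
  (* Exchanging [a] for both [x] and [y] would enlarge the maximum clique. *)
  suff /Kmax : clique (x |: (y |: K :\ a)) && (x |: (y |: K :\ a) \subset S).
    by rewrite !cardsU1 xyK notK // (cardsD1 a K) aK ltnn.
  rewrite !subUset !sub1set xS yS (subset_trans (subD1set _ _)) // !andbT.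
  have cx := adjK x Mxa; have cy := adjK y Mya.
  apply/cliqueP=> u v; rewrite !inE.
  move=> /or3P[/eqP->|/eqP->|/andP[ua uK]] /or3P[/eqP->|/eqP->|/andP[va vK]] uv;
    do ?[by rewrite eqxx in uv | by [] | by rewrite adj_sym | exact: cx | exact: cy].
  - by rewrite adj_sym cx.
  - by rewrite adj_sym cy.
  - exact: (cliqueP _ Kcl).
(* Pascal's rule: singletons and pairs in [K] together number ['C(#|K|.+1, 2)]. *)
- apply: (leq_trans (leq_card_setU _ _)); rewrite !cards_draws addnC -binS.
  by apply: leq_bin2l; rewrite ltnS; apply: Sm.
Qed.

Definition nbhd v := [set x | adj v x].

(** * Colouring from neighbourhoods in the absence of K_1 + 2K_2 *)

Section ButterflyFree.
Hypothesis GK : induced_free G (join_graph (complete_graph 1)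
                                     (copies_graph 2 (complete_graph 2))).

(** A clique in the neighbourhood grows by [v], so Wagon's bound applies with [m] one less than the
    clique number; an induced 2K_2 there would complete K_1 + 2K_2 with centre [v]. *)
Lemma nbhd_set_colorable v : set_colorable (nbhd v) 'C(clique_number G, 2).
Proof.
have cl A : clique A -> A \subset nbhd v -> #|A| < clique_number G.
  move=> Acl /subsetP Av.
  have vA : v \notin A by apply/negP=> /Av; rewrite inE adj_irr.
  have <- : #|v |: A| = #|A|.+1 by rewrite cardsU1 vA.
  apply: clique_card; apply/cliqueP=> x y.
  rewrite !inE => /predU1P[->|xA] /predU1P[->|yA]; rewrite ?eqxx //.
  - by move=> _; have := Av y yA; rewrite inE.
  - by move=> _; have := Av x xA; rewrite inE adj_sym.
  - exact: (cliqueP _ Acl).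
have omega0 : 0 < clique_number G.
  apply: (leq_ltn_trans _ (cl set0 _ _)); rewrite ?cards0 ?sub0set //.
  by apply/cliqueP=> x y; rewrite inE.
rewrite -(prednK omega0); apply: twoK2_free_set_colorable => [a b c d|K Kcl Kv].
  by rewrite !inE; apply: butterfly_free_nbhd.
by rewrite -ltnS prednK // cl.
Qed.

(** Open neighbourhoods suffice: [p] and [r] lie in that of [q], and [q] in that of [p]. *)
Lemma dominating_path3_set_colorable (D : {set G}) : path3 D -> closed_nbhd D = setT ->
  set_colorable setT (3 * 'C(clique_number G, 2)).
Proof.
move=> [p [q [r [-> pq qr]]]] DT.
have := set_colorableU (set_colorableU (nbhd_set_colorable p) (nbhd_set_colorable q))
                       (nbhd_set_colorable r).
apply: set_colorableS; last by lia.
apply/subsetP=> x _; have : x \in closed_nbhd [set p; q; r] by rewrite DT.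
case/closed_nbhdP=> d; rewrite !inE -orbA.
move=> /or3P[] /eqP-> /predU1P[->|xd];
  rewrite ?pq ?qr ?(adj_sym q p) ?pq ?(adj_sym r q) ?qr ?orbT //.
- by rewrite adj_sym xd.
- by rewrite (adj_sym q) xd orbT.
- by rewrite (adj_sym r) xd orbT.
Qed.

(* Two vertices [a], [b] of [K] leave uncovered only vertices seen by some
   other vertex [v] of [K]; two adjacent such vertices seen by the same [v]
   would form, with the triangle [vab], a copy of [K_1 + 2K_2]. *)
Lemma dominating_clique_set_colorable K : 2 <= clique_number G ->
  K != set0 -> clique K -> closed_nbhd K = setT ->
  set_colorable setT (3 * 'C(clique_number G, 2)).
Proof.
move=> omega2 /set0Pn[a aK] Kcl KT.
(* Makes the at most [clique_number G - 2] colours of the uncovered part fit into the third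
   binomial. *)
have omegaC : clique_number G <= 'C(clique_number G, 2) + 1.
  by case: (clique_number G) omega2 => [|[|n]] // _; rewrite binS bin1; lia.
have bin_pos : 0 < 'C(clique_number G, 2) by lia.
have dom x : exists2 d, d \in K & (x == d) || adj x d.
  by apply/closed_nbhdP; rewrite KT in_setT.
have Kle := clique_card Kcl.
(* If [K] is just [a], its neighbourhood and one extra colour for [a] cover the graph. *)
have [K1|] := boolP (K \subset [set a]).
  apply: set_colorableS (set_colorableU (nbhd_set_colorable a) (set_colorable1 a));
    last by lia.
  apply/subsetP=> x _; case: (dom x) => d /(subsetP K1) /set1P-> /predU1P[->|xa].
    by rewrite !inE eqxx orbT.
  by rewrite !inE adj_sym xa.
case/subsetPn=> b bK; rewrite inE => ba.
have ab : adj a b by apply: (cliqueP _ Kcl) => //; rewrite eq_sym.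
pose R := ~: (nbhd a :|: nbhd b).
have Rcol : set_colorable R #|K :\ a :\ b|.
  (* A vertex of [R] sees neither [a] nor [b], so it lies outside [K] and is dominated by another
     vertex of [K]; the default [a] is never taken on [R]. *)
  pose f x := odflt a [pick d in K :\ a :\ b | adj d x].
  have fP x : x \in R -> f x \in K :\ a :\ b /\ adj (f x) x.
    move=> xR; have /andP[ax bx] : ~~ adj a x && ~~ adj b x.
      by move: xR; rewrite !inE negb_or.
    rewrite /f; case: pickP => [d /andP[]//|none].
    case: (dom x) => d dK xd.
    have da : d != a.
      apply: contraTneq xd => ->; rewrite (adj_sym x) (negbTE ax) orbF.
      by apply: contraNneq bx => ->; rewrite adj_sym.
    have db : d != b.
      apply: contraTneq xd => ->; rewrite (adj_sym x) (negbTE bx) orbF.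
      by apply: contraNneq ax => ->.
    have xd' : adj d x.
      case/predU1P: xd => [xd|]; last by rewrite adj_sym.
      case/negP: ax; rewrite xd; apply: (cliqueP _ Kcl) => //.
      by rewrite eq_sym.
    by have := none d; rewrite !inE da db dK xd'.
  apply: (@set_colorable_fin _ (K :\ a :\ b) f) => // [x xR|x y xR yR xy].
    by have [] := fP x xR.
  apply/eqP=> fxy; have [fK fx] := fP x xR; have [_ fy] := fP y yR.
  rewrite -fxy in fy; move: fK; rewrite !inE => /and3P[fb fa fK].
  move: xR yR; rewrite !inE !negb_or =>
    /andP[/negbTE ax /negbTE bx] /andP[/negbTE ay /negbTE by_].
  by apply: (butterfly_free_nbhd GK (v := f x) (a := a) (b := b) (c := x) (d := y)) => //;
    apply: (cliqueP _ Kcl).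
have cardK : #|K :\ a :\ b| + 2 = #|K|.
  by rewrite (cardsD1 a K) aK (cardsD1 b (K :\ a)) !inE ba bK /=; lia.
apply: set_colorableS (set_colorableU (set_colorableU (nbhd_set_colorable a)
  (nbhd_set_colorable b)) Rcol); last by lia.
by rewrite /R setUCr.
Qed.

End ButterflyFree.
End Coloring.

(** * Assembling the bound over the rationals *)

Lemma clique_number_gt0 (G : sgraph) : 0 < clique_number G -> exists x : G, true.
Proof.
have [x _|noG] := pickP (fun _ : G => true); first by exists x.
rewrite lt0n => /negP[]; rewrite -leqn0; apply/bigmax_leqP=> A _.
by rewrite leqn0 cards_eq0; apply/eqP/setP=> x; have := noG x.
Qed.

Local Open Scope ring_scope.

(** Since [n ^ 2 - n] is [2 * 'C(n, 2)], both bounds agree; the identity is first shown additively,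
    avoiding truncated subtraction in [nat]. *)
Lemma le_3bin2_rat (k n : nat) : (k <= 3 * 'C(n, 2))%N ->
  k%:R <= 3%:R / 2%:R * (n%:R ^+ 2 - n%:R) :> rat.
Proof.
have nn : (2 * 'C(n, 2) + n = n * n)%N.
  by rewrite -mul_bin_diag bin1 addnC -mulnS; case: n.
have -> : n%:R ^+ 2 - n%:R = 2%:R * 'C(n, 2)%:R :> rat.
  by rewrite GRing.expr2 -GRing.natrM -nn GRing.natrD GRing.natrM GRing.addrK.
by rewrite -(Num.Theory.ler_nat rat) GRing.natrM => k_le; lra.
Qed.

Theorem theorem1p3 (G : sgraph)
    (Gconn : connected G)
    (Gomega : (2 <= clique_number G)%N)
    (GP5 : induced_free G (path_graph 5))
    (GK : induced_free G (join_graph (complete_graph 1)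
                                     (copies_graph 2 (complete_graph 2)))) :
  (chromatic_number G)%:R <=
    3%:R / 2%:R * ((clique_number G)%:R ^+ 2 - (clique_number G)%:R) :> rat.
Proof.
have [x _] := clique_number_gt0 (ltnW Gomega).
have [D Dgood DT] := P5_free_dominating GP5 Gconn x.
have /chromatic_number_le : set_colorable [set: G] (3 * 'C(clique_number G, 2)).
  case: Dgood => [[D0 Dcl]|Dp]; first exact: dominating_clique_set_colorable DT.
  exact: dominating_path3_set_colorable DT.
exact: le_3bin2_rat.
Qed.
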